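(* Assume that the maximal block Jacobi operator $J$ is self-adjoint and let $z\in\mathbb{C}\setminus\mathbb{R}$. Let $W(z)$ be the matrix Weyl coefficient for $J$ and $z$, let $\tilde U(z)=(\tilde U_n(z))_{n\ge 0}$ be the matrix sequence with columns $u^{(j)}(z)=(J-zI)^{-1}\delta_0(e_j)$, and let $U(z)=(U_n(z))_{n\ge -1}$ be the Weyl matrix solution for $J$ and $z$. Then for any $\nu\in\mathbb{C}^d$ $$\frac{1}{\operatorname{Im} z}\big\langle (\operatorname{Im} W(z))\nu,\nu\big\rangle_{\mathbb{C}^d}=\|\tilde U(z)\nu\|^2_{\ell^2}=\|U(z)\nu\|^2_{[0,+\infty]}\ \ge\ \|W(z)\nu\|^2 .$$ Moreover, the matrix $\operatorname{Im} W(z)$ is strictly positive if $\operatorname{Im} z>0$ and strictly negative if $\operatorname{Im} z<0$, and $$\|\tilde U(z)\|^2_{\ell^2(\mathbb{N}_0,M_d(\mathbb{C}))}=\|U(z)\|^2_{[0,+\infty]}\le \frac{\operatorname{tr}(\operatorname{Im} W(z))}{\operatorname{Im} z}.$$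
   Context: Let $d\in\mathbb{N}$, $\mathbb{N}_k=\{n\in\mathbb{Z}:n\ge k\}$, and let $(A_n)_{n\ge0},(B_n)_{n\ge 0}$ be sequences in $M_d(\mathbb{C})$ with $\det A_n\ne0$ and $B_n=B_n^*$ for all $n\ge0$; put $A_{-1}:=-I$. $M_d(\mathbb{C})$ carries the operator norm; scalar products are linear in the first variable; $e_1,\dots,e_d$ is the standard basis of $\mathbb{C}^d$. The formal block Jacobi operator acts on all sequences $u=(u_n)_{n\ge0}$ in $\mathbb{C}^d$ by $(\mathcal{J}u)_0=B_0u_0+A_0u_1$, $(\mathcal{J}u)_n=A_{n-1}^*u_{n-1}+B_nu_n+A_nu_{n+1}$ for $n\ge1$. The maximal block Jacobi operator $J$ in the Hilbert space $\ell^2(\mathbb{N}_0,\mathbb{C}^d)$ is the restriction of $\mathcal{J}$ to $\mathrm{Dom}(J)=\{u\in\ell^2(\mathbb{N}_0,\mathbb{C}^d):\mathcal{J}u\in\ell^2(\mathbb{N}_0,\mathbb{C}^d)\}$. For a normed space $X$, $\ell^2(\mathbb{N}_k,X)$ is the space of sequences $x=(x_n)_{n\ge k}$ in $X$ with $\|x\|_{\ell^2}^2=\sum_{n\ge k}\|x_n\|_X^2<\infty$. For a sequence $x$ (indexed by $\mathbb{N}_{-1}$ or $\mathbb{N}_0$) in $X$, $\|x\|_{[0,+\infty]}:=\big(\sum_{n\ge0}\|x_n\|_X^2\big)^{1/2}$. For $v\in\mathbb{C}^d$, $\delta_0(v)$ is the sequence with $v$ at position $0$ and $0$ elsewhere.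 For a matrix sequence $V$ and $\nu\in\mathbb{C}^d$, $V\nu:=(V_n\nu)_n$. For $A\in M_d(\mathbb{C})$, $\operatorname{Im}A:=\frac1{2i}(A-A^* )$. For $z\in\mathbb{C}$, $P(z)=(P_n(z))_{n\ge-1}$ and $Q(z)=(Q_n(z))_{n\ge -1}$ are the $M_d(\mathbb{C})$-valued solutions of $A_{n-1}^*U_{n-1}+B_nU_n+A_nU_{n+1}=zU_n$, $n\ge0$, with $P_{-1}=0,\ P_0=I$ and $Q_{-1}=I,\ Q_0=0$. If $J$ is self-adjoint and $z\in\mathbb{C}\setminus\mathbb{R}$: the matrix Weyl coefficient $W(z)$ is the unique matrix in $M_d(\mathbb{C})$ with $P(z)W(z)+Q(z)\in\ell^2(\mathbb{N}_{-1},M_d(\mathbb{C}))$. Let $u^{(j)}(z):=(J-zI)^{-1}\delta_0(e_j)$, $j=1,\dots,d$; $\tilde U(z)$ is the sequence in $M_d(\mathbb{C})$ whose $n$-th term ($n\ge0$) is the matrix with columns $u^{(1)}_n(z),\dots,u^{(d)}_n(z)$. The Weyl matrix solution $U(z)$ is the extension of $\tilde U(z)$ to $\mathbb{N}_{-1}$ given by $U_n(z)=\tilde U_n(z)$ for $n\ge0$ and $U_{-1}(z)=(B_0-zI)\tilde U_0(z)+A_0\tilde U_1(z)$. *)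

(* Defs.v *)
From HB Require Import structures.
From mathcomp Require Import all_boot all_order all_algebra.
From mathcomp Require Import sesquilinear spectral.
From mathcomp Require Import complex.
From mathcomp Require Import all_classical all_reals all_analysis.

Set Implicit Arguments.
Unset Strict Implicit.
Unset Printing Implicit Defensive.

Import Order.TTheory GRing.Theory Num.Theory.
Import numFieldNormedType.Exports.

Local Open Scope classical_set_scope.
Local Open Scope ring_scope.
Local Open Scope sesquilinear_scope.
Local Open Scope complex_scope.

Section FiniteDim.
Context {R : realType} {d : nat}.
Local Notation C := R[i].

(* [dotmx u v] is [u *m v ^t*] on row vectors: linear in the first variable. *)
Definition dotv (u v : 'cV[C]_d) : C := dotmx u^T v^T.

Definition normv (v : 'cV[C]_d) : R := Num.sqrt (complex.Re (dotv v v)).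

Definition opnorm (M : 'M[C]_d) : R :=
  sup [set normv (M *m v) | v in [set v : 'cV[C]_d | normv v <= 1]].

Definition Immx (M : 'M[C]_d) : 'M[C]_d := (2 * 'i)^-1 *: (M - M ^t*).

(* In the order of [R[i]], [0 < c] means that [c] is real and positive. *)
Definition strictly_positive (M : 'M[C]_d) : Prop :=
  forall v : 'cV[C]_d, v != 0 -> 0 < dotv (M *m v) v.

Definition strictly_negative (M : 'M[C]_d) : Prop :=
  forall v : 'cV[C]_d, v != 0 -> dotv (M *m v) v < 0.

Definition e_ (j : 'I_d) : 'cV[C]_d := delta_mx j 0.

End FiniteDim.

(* A sequence indexed by {-1, 0, 1, ...} is encoded as a function on [nat]     *)
(* whose value at [k] is the term of index [k - 1].                           *)

Section SquareSummable.
Context {R : realType} {X : Type} (nrm : X -> R).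

(* The square of the l^2 norm, [+oo] outside of l^2. Because of the shift, it  *)
(* applies to sequences indexed from [0] as well as from [-1].                *)
Definition l2normsq (x : nat -> X) : \bar R :=
  (\sum_(0 <= n <oo) ((nrm (x n)) ^+ 2)%:E)%E.

Definition l2 (x : nat -> X) : Prop := (l2normsq x < +oo)%E.

(* The square of the seminorm [0,+oo] of a sequence indexed from [-1]. *)
Definition seminorm0sq (x : nat -> X) : \bar R := l2normsq (fun n => x n.+1).

End SquareSummable.

Section Operators.
Context {R : realType} {d : nat}.
Local Notation C := R[i].
Local Notation V := (nat -> 'cV[C]_d).

(* The scalar product of l^2; the complex series is summed componentwise. *)
Definition l2dot (x y : V) : C :=
  (limn (series (fun n => complex.Re (dotv (x n) (y n)))))
  +i* (limn (series (fun n => complex.Im (dotv (x n) (y n))))).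

(* An operator in l^2 is given by its domain [D] and its action [T] on [D]. *)

Definition l2_dense (D : set V) : Prop :=
  forall f : V, l2 normv f -> forall e : R, 0 < e ->
  exists2 u, D u & (l2normsq normv (fun n => (f n - u n)%R) < e%:E)%E.

(* [(v, w)] belongs to the graph of the adjoint of [(D, T)]. *)
Definition adjoint_graph (D : set V) (T : V -> V) (v w : V) : Prop :=
  [/\ l2 normv v, l2 normv w & forall u, D u -> l2dot (T u) v = l2dot u w].

Definition selfadjoint (D : set V) (T : V -> V) : Prop :=
  l2_dense D /\ forall v w, adjoint_graph D T v w <-> (D v /\ w = T v).

(* The value at [f] of the inverse of [T - z], a junk value if [f] has no     *)
(* preimage in [D].                                                           *)
Definition resolvent (D : set V) (T : V -> V) (z : C) (f : V) : V :=
  xget (fun=> 0) [set u | D u /\ (fun n => T u n - z *: u n) = f].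

Definition delta0 (v : 'cV[C]_d) : V := fun n => if n is 0 then v else 0.

End Operators.

Section Jacobi.
Context {R : realType} {d : nat}.
Local Notation C := R[i].
Variables (A B : nat -> 'M[C]_d).

Definition Jformal (u : nat -> 'cV[C]_d) (n : nat) : 'cV[C]_d :=
  match n with
  | 0 => B 0%N *m u 0%N + A 0%N *m u 1%N
  | m.+1 => (A m) ^t* *m u m + B m.+1 *m u m.+1 + A m.+1 *m u m.+2
  end.

Definition domJ : set (nat -> 'cV[C]_d) :=
  [set u | l2 normv u /\ l2 normv (Jformal u)].

(* [Aprev n] is [A_(n-1)], with the convention [A_(-1) = - I]. *)
Definition Aprev (n : nat) : 'M[C]_d := if n is m.+1 then A m else - 1%:M.

Fixpoint gsol_pair (z : C) (X Y : 'M[C]_d) (n : nat) : 'M[C]_d * 'M[C]_d :=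
  if n is m.+1 then
    let: (U', U) := gsol_pair z X Y m in
    (U, invmx (A m) *m (z *: U - B m *m U - (Aprev m) ^t* *m U'))
  else (X, Y).

(* The solution, indexed from [-1], with terms [X] and [Y] at [-1] and [0]. *)
Definition gsol (z : C) (X Y : 'M[C]_d) (n : nat) : 'M[C]_d :=
  (gsol_pair z X Y n).1.

Lemma gsolP (z : C) (X Y : 'M[C]_d) (U : nat -> 'M[C]_d) :
  (forall n, \det (A n) != 0) ->
  [/\ U 0%N = X, U 1%N = Y &
    forall n, (Aprev n) ^t* *m U n + B n *m U n.+1 + A n *m U n.+2
              = z *: U n.+1]
  <-> U = gsol z X Y.
Proof.
move=> dA.
have uA n : A n \in unitmx by rewrite unitmxE unitfE.
have gS n : (gsol_pair z X Y n).2 = gsol z X Y n.+1.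
  by rewrite /gsol /=; case: (gsol_pair _ _ _ _).
have gSS n : gsol z X Y n.+2 = invmx (A n) *m
    (z *: gsol z X Y n.+1 - B n *m gsol z X Y n.+1 - (Aprev n) ^t* *m gsol z X Y n).
  by rewrite -[LHS]gS -gS /gsol /=; case: (gsol_pair _ _ _ _).
split=> [[U0 U1 UE]|->].
  have H n : U n = gsol z X Y n /\ U n.+1 = gsol z X Y n.+1.
    elim: n => [|n [IH IH1]]; first by [].
    split=> //; rewrite gSS -IH -IH1 -UE [_ + B n *m _ + _]addrAC addrK.
    by rewrite [_ + A n *m _]addrC addrK mulKmx.
  by apply/funext => n; case: (H n).
split=> // n; rewrite gSS mulKVmx //.
set a := _ *m _; set b := B n *m _; set w := z *: _.
by rewrite -[w - b - a]addrA -opprD (addrC b a) [LHS]addrC subrK.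
Qed.

Definition P_ (z : C) : nat -> 'M[C]_d := gsol z 0 1%:M.
Definition Q_ (z : C) : nat -> 'M[C]_d := gsol z 1%:M 0.

(* [0] if there is no such matrix; for [J] self-adjoint and [z] not real there *)
(* is exactly one.                                                            *)
Definition weyl_coef (z : C) : 'M[C]_d :=
  xget 0 [set W | l2 opnorm (fun n => P_ z n *m W + Q_ z n)].

Definition weyl_vec (z : C) (j : 'I_d) : nat -> 'cV[C]_d :=
  resolvent domJ Jformal z (delta0 (e_ j)).

Definition weyl_tilde (z : C) (n : nat) : 'M[C]_d :=
  \matrix_(i, j) weyl_vec z j n i 0.

Definition weyl_sol (z : C) (n : nat) : 'M[C]_d :=
  if n is m.+1 then weyl_tilde z m
  else (B 0%N - z%:M) *m weyl_tilde z 0%N + A 0%N *m weyl_tilde z 1%N.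

End Jacobi.

(* Main.v *)
Require Import Defs.
From HB Require Import structures.
From mathcomp Require Import all_boot all_order all_algebra.
From mathcomp Require Import sesquilinear spectral.
From mathcomp Require Import complex.
From mathcomp Require Import all_classical all_reals all_analysis.
From mathcomp Require Import ring lra.

Import Order.TTheory GRing.Theory Num.Theory.
Import numFieldNormedType.Exports.

Local Open Scope ring_scope.
Local Open Scope sesquilinear_scope.

(** The columns of [U(z)] are the square-summable solutions of the recurrence,
    and the identity for [Im W(z)] is Green's formula for them, with the
    boundary term at infinity killed by self-adjointness.

    For [nu] in [C^d] let [u = (P W + Q) nu], so that [u_(-1) = nu] and
    [u_0 = W nu].  Deleting the term of index [-1] gives an element of the domain
    of [J] with [(J - z) u = delta_0 nu] ([Jformal_solution]).  Since [J] is
    self-adjoint, [<J u, u>] is real; as [J u = z u + delta_0 nu], taking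
    imaginary parts gives
      [Im z * ||u||^2 = - Im <nu, u_0> = Im <W nu, nu>]
    ([l2normsq_resolvent_eq]), and the right-hand side is [<(Im W) nu, nu>].
    The case [nu = 0] says that [J - z] is injective, so [u] is the
    resolvent applied to [delta_0 nu], that is [Ut nu = u] ([weyl_tilde_mulmx]).
    The inequality keeps the first term [||u_0||^2 = ||W nu||^2] of the series.
    Strictness holds because [u = 0] would give [nu = (J - z) u = 0] at index [0].
    The trace bound sums the identity over the standard basis, an operator norm
    being at most the Hilbert-Schmidt norm.

    Both [W] and the resolvent have to be shown to exist.  This is Weyl's
    compactness argument, which works for any Hermitian Jacobi matrix.
    Truncated at [n], the recurrence has a solution with [u_(-1) = e] and
    [u_n = 0], since Green's formula makes [P_n] injective ([P_unitmx]); the same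
    formula bounds the sum of [||u_k||^2] over [k < n] by
    [||e||^2 / (Im z)^2], uniformly in [n] ([truncated_solution]).  Hence the
    initial values [u_0] are bounded, and any limit point of them
    is the initial value of a square-summable solution
    ([square_summable_solution]). *)

Set Implicit Arguments.
Unset Strict Implicit.
Unset Printing Implicit Defensive.

(** * Real and imaginary parts *)

Section ComplexParts.
Context {R : realType}.
Implicit Types x y : R[i].

Lemma ReD x y : complex.Re (x + y) = complex.Re x + complex.Re y.
Proof. by case: x y => [a b] [c e]. Qed.

Lemma ImD x y : complex.Im (x + y) = complex.Im x + complex.Im y.
Proof. by case: x y => [a b] [c e]. Qed.

Lemma ReM x y : complex.Re (x * y) =
  complex.Re x * complex.Re y - complex.Im x * complex.Im y.
Proof. by case: x y => [a b] [c e]. Qed.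

Lemma ImM x y : complex.Im (x * y) =
  complex.Re x * complex.Im y + complex.Im x * complex.Re y.
Proof. by case: x y => [a b] [c e]. Qed.

Lemma ReC x : complex.Re x^* = complex.Re x.
Proof. by case: x. Qed.

Lemma ImC x : complex.Im x^* = - complex.Im x.
Proof. by case: x. Qed.

Lemma Re_sum (I : finType) (F : I -> R[i]) :
  complex.Re (\sum_i F i) = \sum_i complex.Re (F i).
Proof. exact: (big_morph _ ReD). Qed.

Lemma Im_sum (I : finType) (F : I -> R[i]) :
  complex.Im (\sum_i F i) = \sum_i complex.Im (F i).
Proof. exact: (big_morph _ ImD). Qed.

Lemma complex_eq x y : complex.Re x = complex.Re y ->
  complex.Im x = complex.Im y -> x = y.
Proof. by case: x y => [a b] [c e] /= -> ->. Qed.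

End ComplexParts.

(** * Scalar product and operator norm on [C^d] *)

Section FiniteDim.
Context {R : realType} {d : nat}.
Local Notation C := R[i].
Implicit Types (u v w : 'cV[C]_d) (M : 'M[C]_d).

Lemma dotvE u v : dotv u v = (v^t* *m u) 0 0.
Proof.
rewrite /dotv dotmxE !mxE; apply: eq_bigr => i _.
by rewrite !mxE mulrC.
Qed.

Lemma dotvDl u v w : dotv (u + v) w = dotv u w + dotv v w.
Proof. by rewrite !dotvE mulmxDr !mxE. Qed.

Lemma dotvZl a u v : dotv (a *: u) v = a * dotv u v.
Proof. by rewrite !dotvE -scalemxAr !mxE. Qed.

Lemma dot0v v : dotv 0 v = 0.
Proof. by rewrite !dotvE mulmx0 !mxE. Qed.

Lemma dotvC u v : dotv v u = (dotv u v)^*.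
Proof.
rewrite !dotvE !mxE rmorph_sum; apply: eq_bigr => i _ /=.
rewrite !mxE.
by apply: complex_eq; rewrite ?(ReM, ImM, ReC, ImC); ring.
Qed.

Lemma dotv0 v : dotv v 0 = 0.
Proof. by rewrite dotvC dot0v conjC0. Qed.

Lemma mulmx_trC m n p (M : 'M[C]_(m, n)) (N : 'M[C]_(n, p)) :
  (M *m N)^t* = N^t* *m M^t*.
Proof. by rewrite trmx_mul map_mxM. Qed.

Lemma dotv_mull M u v : dotv (M *m u) v = dotv u (M^t* *m v).
Proof. by rewrite !dotvE mulmx_trC trmxCK mulmxA. Qed.

(** The square of [normv], kept as a notion of its own because, unlike
    [normv], it is polynomial in the real coordinates. *)
Definition nsq v : R := complex.Re (dotv v v).

Lemma nsqE v : nsq v =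
  \sum_i ((complex.Re (v i 0)) ^+ 2 + (complex.Im (v i 0)) ^+ 2).
Proof.
rewrite /nsq dotvE mxE Re_sum; apply: eq_bigr => i _.
by rewrite !mxE ReM ReC ImC; ring.
Qed.

Lemma nsq_ge0 v : 0 <= nsq v.
Proof. by rewrite nsqE sumr_ge0 // => i _; rewrite addr_ge0 ?sqr_ge0. Qed.

Lemma normvK v : normv v ^+ 2 = nsq v.
Proof. by rewrite sqr_sqrtr // nsq_ge0. Qed.

Lemma nsq_eq0 v : nsq v = 0 -> v = 0.
Proof.
rewrite nsqE => /eqP; rewrite psumr_eq0; last first.
  by move=> i _; rewrite addr_ge0 ?sqr_ge0.
move/allP => H; apply/matrixP => i j; rewrite (ord1 j) mxE.
have := H i (mem_index_enum i); rewrite /= paddr_eq0 ?sqr_ge0 // !sqrf_eq0.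
by move=> /andP[/eqP a /eqP b]; apply: complex_eq.
Qed.

Lemma nsq0 : nsq 0 = 0.
Proof. by rewrite /nsq dot0v. Qed.

Lemma dotvv v : dotv v v = (nsq v)%:C%C.
Proof.
apply: complex_eq => //=; have := congr1 (@complex.Im R) (dotvC v v).
by rewrite ImC => h; lra.
Qed.

Lemma nsqZ a v : nsq (a *: v) = (complex.Re a ^+ 2 + complex.Im a ^+ 2) * nsq v.
Proof.
rewrite !nsqE mulr_sumr; apply: eq_bigr => i _.
by rewrite mxE ReM ImM; ring.
Qed.

Lemma nsqD_le u v : nsq (u + v) <= 2 * nsq u + 2 * nsq v.
Proof.
rewrite !nsqE !mulr_sumr -big_split /=; apply: ler_sum => i _.
rewrite mxE ReD ImD.
set a := complex.Re _; set b := complex.Re _.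
set e := complex.Im _; set f := complex.Im _.
have := sqr_ge0 (a - b); have := sqr_ge0 (e - f); lra.
Qed.

Lemma cauchy_schwarz u v :
  complex.Re (dotv u v) ^+ 2 + complex.Im (dotv u v) ^+ 2 <= nsq u * nsq v.
Proof.
have : `|dotv u v| ^+ 2 <= dotv u u * dotv v v.
  exact: leif_le (CauchySchwarz (@dotmx R[i] d) u^T v^T).
by rewrite !dotvv -add_Re2_Im2 -rmorphM lecR.
Qed.


(** Row by row, the Cauchy-Schwarz inequality bounds the action of [M] by its
    Hilbert-Schmidt norm. *)
Lemma nsq_mulmx_le M v :
  nsq (M *m v) <= (\sum_j nsq (M *m e_ j)) * nsq v.
Proof.
have -> : \sum_j nsq (M *m e_ j) = \sum_i nsq ((row i M)^t*).
  transitivity (\sum_j \sum_i (complex.Re ((M *m e_ j) i 0) ^+ 2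
      + complex.Im ((M *m e_ j) i 0) ^+ 2)).
    by apply: eq_bigr => j _; exact: nsqE.
  rewrite exchange_big; apply: eq_bigr => i _.
  rewrite nsqE; apply: eq_bigr => j _.
  by rewrite -colE !mxE ReC ImC sqrrN.
rewrite nsqE mulr_suml; apply: ler_sum => i _.
have -> : (M *m v) i 0 = dotv v ((row i M)^t*).
  by rewrite dotvE trmxCK -row_mul [RHS]mxE.
by rewrite mulrC; exact: cauchy_schwarz.
Qed.

Lemma has_sup_opnorm M :
  has_sup [set normv (M *m v) | v in [set v : 'cV[C]_d | normv v <= 1]].
Proof.
split; first by exists (normv (M *m 0)), 0 => //=; rewrite /normv dot0v sqrtr0.
exists (Num.sqrt (\sum_j nsq (M *m e_ j))) => _ [v /= v1 <-].
rewrite ler_sqrt ?sumr_ge0 // => [|i _]; last exact: nsq_ge0.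
apply: le_trans (nsq_mulmx_le M v) _.
rewrite ler_piMr ?sumr_ge0 // => [i _|]; first exact: nsq_ge0.
by rewrite -normvK expr_le1 // sqrtr_ge0.
Qed.

Lemma opnorm_ge0 M : 0 <= opnorm M.
Proof.
apply: le_trans (sqrtr_ge0 (nsq (M *m 0))) _.
apply: sup_upper_bound; first exact: has_sup_opnorm.
by exists 0 => //=; rewrite /normv dot0v sqrtr0.
Qed.

Lemma opnorm_sq_le M : opnorm M ^+ 2 <= \sum_j nsq (M *m e_ j).
Proof.
have S0 : 0 <= \sum_j nsq (M *m e_ j).
  by rewrite sumr_ge0 // => i _; exact: nsq_ge0.
rewrite -[leRHS]sqr_sqrtr // lerXn2r ?nnegrE ?sqrtr_ge0 ?opnorm_ge0 //.
apply: ge_sup; first by have [] := has_sup_opnorm M.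
move=> _ [v /= v1 <-]; rewrite ler_sqrt //.
apply: le_trans (nsq_mulmx_le M v) _; rewrite ler_piMr //.
by rewrite -normvK expr_le1 // sqrtr_ge0.
Qed.

Lemma nsq_mulmx_opnorm M v : nsq (M *m v) <= opnorm M ^+ 2 * nsq v.
Proof.
have [v0|v0] := eqVneq (nsq v) 0.
  by rewrite (nsq_eq0 v0) mulmx0 nsq0 mulr0.
have v_gt0 : 0 < nsq v by rewrite lt_neqAle eq_sym v0 nsq_ge0.
have n_gt0 : 0 < normv v by rewrite sqrtr_gt0.
(* The supremum defining [opnorm] is tested at the unit vector [v / |v|]. *)
pose a : C := ((normv v)^-1)%:C%C.
have nsqa w : nsq (a *: w) = nsq w / nsq v.
  by rewrite nsqZ /= expr0n addr0 exprVn normvK mulrC.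
rewrite -ler_pdivrMr // -nsqa scalemxAr -normvK.
rewrite lerXn2r ?nnegrE ?sqrtr_ge0 ?opnorm_ge0 //.
apply: sup_upper_bound; first exact: has_sup_opnorm.
exists (a *: v) => //=.
by rewrite /normv -/(nsq _) nsqa divff // sqrtr1.
Qed.

(** [<M^* v, v>] is the conjugate of [<M v, v>], so that the quadratic form of
    [Im M] is the imaginary part of that of [M]. *)
Lemma dotv_Immx M v : dotv (Immx M *m v) v = (complex.Im (dotv (M *m v) v))%:C%C.
Proof.
rewrite /Immx -scalemxAl dotvZl mulmxBl dotvDl -scaleN1r dotvZl.
rewrite [dotv (M^t* *m v) v]dotv_mull trmxCK [dotv v _]dotvC mulN1r.
rewrite [(2 * 'i)^-1]invfM invCi.
have -> : ('i : C) = Complex 0 1 by [].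
case: (dotv _ _) => a b.
apply: (@mulfI _ (2 : C)); first by rewrite pnatr_eq0.
rewrite !mulrA divff ?pnatr_eq0 // mul1r.
by apply: complex_eq; rewrite !(ReM, ImM, ReD, ImD) /=; ring.
Qed.

Lemma mxtrace_Immx M :
  \tr (Immx M) = (\sum_j complex.Im (dotv (M *m e_ j) (e_ j)))%:C%C.
Proof.
rewrite rmorph_sum; apply: eq_bigr => j _ /=.
rewrite -dotv_Immx -colE dotvE [RHS]mxE (bigD1 j) //= big1 => [|i ij].
  rewrite [col j _ j 0]mxE !mxE !eqxx /= conjC1 mul1r addr0 //.
by rewrite !mxE (negPf ij) conjC0 mul0r.
Qed.

End FiniteDim.

(** * Square-summable sequences *)

Section SquareSummable.
Context {R : realType} {d : nat}.
Local Notation C := R[i].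
Implicit Types (x y : nat -> 'cV[C]_d).

Lemma l2normsq_ge m (x : nat -> 'cV[C]_d) :
  ((\sum_(k < m) nsq (x k))%:E <= l2normsq normv x)%E.
Proof.
rewrite -sumEFin -(big_mkord xpredT (fun k => (nsq (x k))%:E)).
under eq_bigr do rewrite -normvK.
by apply: nneseries_lim_ge => n _ _; rewrite lee_fin sqr_ge0.
Qed.

Lemma l2normsq_le (x : nat -> 'cV[C]_d) (c : R) :
  (forall m, \sum_(k < m) nsq (x k) <= c) -> (l2normsq normv x <= c%:E)%E.
Proof.
move=> h; apply: lime_le.
  by apply: is_cvg_nneseries => n _ _; rewrite lee_fin sqr_ge0.
apply: nearW => m; rewrite big_mkord sumEFin lee_fin.
by under eq_bigr do rewrite normvK; exact: h.
Qed.

(** Membership in [l^2] in terms of partial sums, the form in which it is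
    obtained from the estimates on truncations. *)
Lemma l2P x : l2 normv x <-> exists c, forall m, \sum_(k < m) nsq (x k) <= c.
Proof.
split=> [x2|[c /l2normsq_le h]]; last exact: le_lt_trans h (ltry _).
have fx : l2normsq normv x \is a fin_num.
  rewrite ge0_fin_numE //.
  by apply: nneseries_ge0 => n _ _; rewrite lee_fin sqr_ge0.
exists (fine (l2normsq normv x)) => m.
by rewrite -lee_fin fineK //; exact: l2normsq_ge.
Qed.

Lemma l2_combination (a : C) x y : l2 normv x -> l2 normv y ->
  l2 normv (fun n => a *: x n + y n).
Proof.
move=> /l2P[c xc] /l2P[e ye]; apply/l2P.
pose r := complex.Re a ^+ 2 + complex.Im a ^+ 2.
exists (2 * (r * c) + 2 * e) => m.
have r0 : 0 <= r by rewrite addr_ge0 ?sqr_ge0.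
apply: (@le_trans _ _ (\sum_(k < m) (2 * (r * nsq (x k)) + 2 * nsq (y k)))).
  by apply: ler_sum => k _; rewrite -nsqZ; exact: nsqD_le.
rewrite big_split /= -mulr_sumr -[X in _ + X <= _]mulr_sumr -[X in 2 * X + _ <= _]mulr_sumr.
apply: lerD; rewrite ler_pM2l //; last exact: ye.
exact: ler_wpM2l r0 _ _ (xc m).
Qed.

Lemma l2_delta0 (v : 'cV[C]_d) : l2 normv (delta0 v).
Proof.
apply/l2P; exists (nsq v) => -[|m]; first by rewrite big_ord0 nsq_ge0.
by rewrite big_ord_recl big1 /= ?addr0 // => i _; rewrite nsq0.
Qed.

Lemma l2_shift x : l2 normv x -> l2 normv (fun n => x n.+1).
Proof.
move=> /l2P[c xc]; apply/l2P; exists c => m.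
by apply: le_trans (xc m.+1); rewrite big_ord_recl lerDr nsq_ge0.
Qed.

Lemma l2normsq_eq0 x : l2normsq normv x = 0%E -> forall n, x n = 0.
Proof.
move=> x0 n; apply: nsq_eq0; apply/eqP; rewrite eq_le nsq_ge0 andbT.
have := l2normsq_ge n.+1 x; rewrite x0 lee_fin big_ord_recr /=.
by apply: le_trans; rewrite lerDr sumr_ge0 // => i _; exact: nsq_ge0.
Qed.

Lemma l2_series_cvg x : l2 normv x ->
  cvgn (series (fun n => nsq (x n))) /\
  l2normsq normv x = (limn (series (fun n => nsq (x n))))%:E.
Proof.
move=> /l2P[c xc].
have cv : cvgn (series (fun n => nsq (x n))).
  apply: nondecreasing_is_cvgn.
    apply/nondecreasing_seqP => n; rewrite /series /= big_nat_recr //=.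
    by rewrite lerDl nsq_ge0.
  by exists c => _ [n _ <-]; rewrite /series /= big_mkord.
split=> //; rewrite -EFin_lim // /l2normsq.
congr (lim (_ @ \oo)%classic); apply/funext => n /=.
by rewrite -sumEFin; under eq_bigr do rewrite normvK.
Qed.

End SquareSummable.

Section SquareSummableMatrices.
Context {R : realType} {d : nat}.
Implicit Types (M : nat -> 'M[R[i]]_d).

(** The operator norm is at most the Hilbert-Schmidt norm, which is computed
    column by column. *)
Lemma l2normsq_opnorm_le M :
  (l2normsq opnorm M <= \sum_j l2normsq normv (fun n => M n *m e_ j))%E.
Proof.
rewrite /l2normsq -nneseries_sum; last first.
  by move=> j n _; rewrite lee_fin sqr_ge0.
apply: lee_nneseries => n _; first by rewrite lee_fin sqr_ge0.
rewrite sumEFin lee_fin; under eq_bigr do rewrite normvK.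
exact: opnorm_sq_le.
Qed.

Lemma l2_opnormP M : l2 opnorm M <->
  forall v : 'cV[R[i]]_d, l2 normv (fun n => M n *m v).
Proof.
split=> [M2 v|Mv].
  apply: (@le_lt_trans _ _ ((nsq v)%:E * l2normsq opnorm M)%E).
    rewrite /l2normsq -nneseriesZl; last by move=> n _; rewrite lee_fin sqr_ge0.
    apply: lee_nneseries => n _; first by rewrite lee_fin sqr_ge0.
    rewrite normvK -EFinM lee_fin mulrC; exact: nsq_mulmx_opnorm.
  rewrite lte_mul_pinfty // ?lee_fin ?nsq_ge0 //.
apply: le_lt_trans (l2normsq_opnorm_le M) _.
by apply: lte_sum_pinfty => j _; exact: Mv.
Qed.

End SquareSummableMatrices.

(** * Coordinatewise limits along an ultrafilter *)

Section CoordinatewiseLimits.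
Context {R : realType} {d : nat}.
Local Notation C := R[i].
Local Open Scope classical_set_scope.

(** Along an ultrafilter a cluster point is a limit.  A single ultrafilter thus
    serves for all coordinates at once, in place of successive extractions of
    subsequences. *)
Lemma ultra_bounded_cvg (F : set_system nat) (FU : UltraFilter F)
    (a : nat -> R) (c : R) : (forall n, `|a n| <= c) ->
  exists l : R, a n @[n --> F] --> l.
Proof.
move=> ac.
have Fa : F (a @^-1` `[- c, c]).
  by apply: filterE => n; rewrite /= in_itv /= -ler_norml.
have [l [_ cl]] := segment_compact (fmap_proper_filter a _) Fa.
exists l => U lU.
have [//|FnU] := in_ultra_setVsetC (a @^-1` U) FU.
by have [y [/= nUy Uy]] := cl (~` U) U FnU lU.
Qed.

Definition vcvg (F : set_system nat) (x : nat -> 'cV[C]_d) (l : 'cV[C]_d) :=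
  forall i, complex.Re (x n i 0) @[n --> F] --> complex.Re (l i 0)
    /\ complex.Im (x n i 0) @[n --> F] --> complex.Im (l i 0).

Lemma nsq_ge_coord (v : 'cV[C]_d) i :
  complex.Re (v i 0) ^+ 2 + complex.Im (v i 0) ^+ 2 <= nsq v.
Proof.
rewrite nsqE (bigD1 i) //= lerDl sumr_ge0 // => k _.
by rewrite addr_ge0 ?sqr_ge0.
Qed.

Lemma ultra_bounded_vcvg (F : set_system nat) (FU : UltraFilter F)
    (x : nat -> 'cV[C]_d) (c : R) : (forall n, nsq (x n) <= c) ->
  exists l, vcvg F x l.
Proof.
move=> xc.
have c0 : 0 <= c := le_trans (nsq_ge0 _) (xc 0%N).
have bnd (t : R) n : t ^+ 2 <= nsq (x n) -> `|t| <= Num.sqrt c.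
  by move=> /le_trans/(_ (xc n)) tc; rewrite -sqrtr_sqr ler_sqrt.
have cR i : exists l : R, complex.Re (x n i 0) @[n --> F] --> l.
  apply: ultra_bounded_cvg => n; apply: (bnd _ n).
  by apply: le_trans (nsq_ge_coord _ i); rewrite lerDl sqr_ge0.
have cI i : exists l : R, complex.Im (x n i 0) @[n --> F] --> l.
  apply: ultra_bounded_cvg => n; apply: (bnd _ n).
  by apply: le_trans (nsq_ge_coord _ i); rewrite lerDr sqr_ge0.
have [lR xR] := choice cR; have [lI xI] := choice cI.
by exists (\col_i Complex (lR i) (lI i)) => i; rewrite !mxE.
Qed.

Lemma cvg_sumr (F : set_system nat) (FF : Filter F) (I : finType)
    (f : I -> nat -> R) (l : I -> R) :
  (forall i, f i n @[n --> F] --> l i) ->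
  \sum_i f i n @[n --> F] --> \sum_i l i.
Proof. by move=> fl; apply: cvg_big => // -[u v]; exact: add_continuous. Qed.

Lemma vcvg_affine (F : set_system nat) (FF : Filter F)
    (x : nat -> 'cV[C]_d) l (M : 'M[C]_d) b :
  vcvg F x l -> vcvg F (fun n => M *m x n + b) (M *m l + b).
Proof.
move=> xl i; split.
  under eq_fun do rewrite !mxE ReD Re_sum.
  rewrite !mxE ReD Re_sum.
  apply: cvgD; last exact: cvg_cst.
  apply: cvg_sumr => j; under eq_fun do rewrite ReM; rewrite ReM.
  by apply: cvgB; apply: cvgM; do ?exact: cvg_cst; have [] := xl j.
under eq_fun do rewrite !mxE ImD Im_sum.
rewrite !mxE ImD Im_sum.
apply: cvgD; last exact: cvg_cst.
apply: cvg_sumr => j; under eq_fun do rewrite ImM; rewrite ImM.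
by apply: cvgD; apply: cvgM; do ?exact: cvg_cst; have [] := xl j.
Qed.

Lemma cvg_nsq (F : set_system nat) (FF : Filter F) (x : nat -> 'cV[C]_d) l :
  vcvg F x l -> nsq (x n) @[n --> F] --> nsq l.
Proof.
move=> xl; under eq_fun do rewrite nsqE; rewrite nsqE.
apply: cvg_sumr => i; have [xR xI] := xl i.
by under eq_fun do rewrite !expr2; rewrite !expr2; apply: cvgD; apply: cvgM.
Qed.

End CoordinatewiseLimits.

(** * Solutions of the recurrence and Green's formula *)

Section Solutions.
Context {R : realType} {d : nat}.
Local Notation C := R[i].
Variables (A B : nat -> 'M[C]_d) (z : C).
Hypothesis detA : forall n, \det (A n) != 0.
Hypothesis hermB : forall n, B n = (B n)^t*.
Hypothesis z_nonreal : complex.Im z != 0.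

Definition solution (w e : 'cV[C]_d) (n : nat) : 'cV[C]_d :=
  P_ A B z n *m w + Q_ A B z n *m e.

Lemma solution0 w e : solution w e 0 = e.
Proof.
have [P0 _ _] := (gsolP B z 0 1%:M (P_ A B z) detA).2 erefl.
have [Q0 _ _] := (gsolP B z 1%:M 0 (Q_ A B z) detA).2 erefl.
by rewrite /solution P0 Q0 mul0mx mul1mx add0r.
Qed.

Lemma solution1 w e : solution w e 1 = w.
Proof.
have [_ P1 _] := (gsolP B z 0 1%:M (P_ A B z) detA).2 erefl.
have [_ Q1 _] := (gsolP B z 1%:M 0 (Q_ A B z) detA).2 erefl.
by rewrite /solution P1 Q1 mul0mx mul1mx addr0.
Qed.

Lemma solution_mulmx (W : 'M[C]_d) v :
  (fun n => (P_ A B z n *m W + Q_ A B z n) *m v) = solution (W *m v) v.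
Proof. by apply/funext => n; rewrite mulmxDl -mulmxA. Qed.

Lemma nsq_le_sum_solution w e n : (0 < n)%N ->
  nsq w <= \sum_(k < n) nsq (solution w e k.+1).
Proof.
case: n => // n _; rewrite big_ord_recl solution1 lerDl sumr_ge0 // => i _.
exact: nsq_ge0.
Qed.

Lemma solution_rec w e n :
  (Aprev A n)^t* *m solution w e n + B n *m solution w e n.+1
    + A n *m solution w e n.+2 = z *: solution w e n.+1.
Proof.
have [_ _ PE] := (gsolP B z 0 1%:M (P_ A B z) detA).2 erefl.
have [_ _ QE] := (gsolP B z 1%:M 0 (Q_ A B z) detA).2 erefl.
rewrite /solution !mulmxDr !scalerDr !scalemxAl -PE -QE !mulmxDl !mulmxA.
by rewrite [RHS]addrACA; congr (_ + _); rewrite addrACA.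
Qed.

(** Dropping the term of index [-1], which [A_(-1) = - I] multiplies, turns the
    recurrence into the inhomogeneous equation with source [e] at [0]. *)
Lemma Jformal_solution w e n :
  Jformal A B (fun k => solution w e k.+1) n =
  z *: solution w e n.+1 + delta0 e n.
Proof.
rewrite -solution_rec; case: n => [|n] /=; last by rewrite addr0.
rewrite solution0 linearN /= trmx1 map_mxN map_mx1.
by rewrite mulNmx mul1mx [RHS]addrC !addrA subrr add0r.
Qed.

(** The boundary term in Green's formula. *)
Definition flux (u : nat -> 'cV[C]_d) n : R :=
  complex.Im (dotv (Aprev A n *m u n.+1) (u n)).

Lemma flux0 u : flux u 0 = - complex.Im (dotv (u 1%N) (u 0%N)).
Proof.
rewrite /flux /Aprev mulNmx mul1mx -scaleN1r dotvZl mulN1r.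
by case: (dotv _ _).
Qed.

Lemma flux_eq0 u n : u n.+1 = 0 -> flux u n = 0.
Proof. by rewrite /flux => ->; rewrite mulmx0 dot0v. Qed.

Lemma Im_balance (p q r : C) (t : R) :
  z * t%:C%C = p^* + q + r -> complex.Im q = 0 ->
  complex.Im z * t = complex.Im r - complex.Im p.
Proof.
move=> /(congr1 (@complex.Im R)) + q0.
by rewrite ImM !ImD ImC q0 /= mulr0 add0r addr0 addrC.
Qed.

(** Pairing the recurrence with [u_k] and taking imaginary parts removes the
    Hermitian coefficient [B_k], and the off-diagonal coefficients contribute the
    difference of two consecutive fluxes; the sum telescopes. *)
Lemma green (u : nat -> 'cV[C]_d) n :
  (forall k, (Aprev A k)^t* *m u k + B k *m u k.+1 + A k *m u k.+2
             = z *: u k.+1) ->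
  complex.Im z * \sum_(k < n) nsq (u k.+1) = flux u n - flux u 0.
Proof.
move=> uE.
rewrite -(@telescope_sumr _ 0 n (flux u)) // big_mkord mulr_sumr.
apply: eq_bigr => k _.
apply: (@Im_balance _ (dotv (B k *m u k.+1) (u k.+1))).
  rewrite -dotvv -dotvZl -uE !dotvDl; congr (_ + _ + _).
  by rewrite [in RHS]dotv_mull -dotvC.
have := congr1 (@complex.Im R) (dotvC (B k *m u k.+1) (u k.+1)).
by rewrite dotv_mull -hermB ImC => h; lra.
Qed.

(** A vector in the kernel of [P_n] gives a solution that vanishes at [-1] and
    at [n], so that both fluxes in Green's formula vanish and the solution is
    zero.  This is the absence of non-real eigenvalues for a finite Hermitian
    matrix. *)
Lemma P_unitmx n : P_ A B z n.+1 \in unitmx.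
Proof.
rewrite -unitmx_tr unitmxE unitfE; apply/det0P => -[v v0 vP].
have Pv : solution v^T 0 n.+1 = 0.
  by rewrite /solution mulmx0 addr0 -[_ *m _]trmxK trmx_mul trmxK vP trmx0.
case/negP: v0; apply/eqP/trmx_inj; rewrite trmx0 -(solution1 v^T 0).
case: n vP Pv => [|n] _ Pv //.
have := green n.+1 (solution_rec v^T 0).
rewrite (flux_eq0 Pv) flux0 solution0 dotv0 oppr0 subr0 => /eqP.
rewrite mulf_eq0 (negPf z_nonreal) /= => /eqP S0; apply: nsq_eq0.
apply/eqP; rewrite eq_le nsq_ge0 andbT -S0 solution1.
exact: nsq_le_sum_solution.
Qed.

(** With [S] the sum and the solution chosen to vanish at [n], Green's formula
    reads [Im z * S = Im <w, e>].  By the Cauchy-Schwarz inequality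
    [(Im z * S)^2 <= nsq w * nsq e], and [nsq w <= S] since [w = u_0]; dividing by
    [S] leaves a bound that depends neither on [w] nor on [n]. *)
Lemma truncated_solution e n : exists w,
  \sum_(k < n) nsq (solution w e k.+1) <= nsq e / complex.Im z ^+ 2.
Proof.
exists (- invmx (P_ A B z n.+1) *m (Q_ A B z n.+1 *m e)).
set w := _ *m _.
have un : solution w e n.+1 = 0.
  by rewrite /solution /w mulNmx mulmxN mulKVmx ?P_unitmx // addNr.
set S := \sum_(k < n) _.
have S0 : 0 <= S by apply: sumr_ge0 => k _; exact: nsq_ge0.
have gS : complex.Im z * S = complex.Im (dotv w e).
  rewrite /S (green n (solution_rec w e)) (flux_eq0 un) flux0.
  by rewrite solution0 solution1 sub0r opprK.
have z2 : 0 < complex.Im z ^+ 2 by rewrite exprn_even_gt0.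
rewrite ler_pdivlMr //.
have [->|Sn] := eqVneq S 0; first by rewrite mul0r nsq_ge0.
have Sp : 0 < S by rewrite lt_neqAle eq_sym Sn.
rewrite -(ler_pM2l Sp).
have wS : nsq w <= S.
  apply: nsq_le_sum_solution; rewrite lt0n.
  by apply: contraNneq Sn => n0; rewrite /S n0 big_ord0.
have -> : S * (S * complex.Im z ^+ 2) = complex.Im (dotv w e) ^+ 2.
  by rewrite -gS; ring.
apply: le_trans (ler_wpM2r (nsq_ge0 e) wS).
by apply: le_trans (cauchy_schwarz w e); rewrite lerDr sqr_ge0.
Qed.

(** The bound on the [n]-th truncation controls every shorter partial sum, and
    a partial sum of fixed length depends continuously on the initial value [w].
    So it passes to the limit. *)
Lemma square_summable_solution e : exists w, l2 normv (solution w e).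
Proof.
pose c := nsq e / complex.Im z ^+ 2.
have [w wP] : {w : nat -> 'cV[C]_d & forall n,
    \sum_(k < n.+1) nsq (solution (w n) e k.+1) <= c}.
  apply: (@choice _ _ (fun n w =>
    \sum_(k < n.+1) nsq (solution w e k.+1) <= c)) => n.
  exact: truncated_solution.
have w_bnd n : nsq (w n) <= c.
  by apply: le_trans (wP n); exact: nsq_le_sum_solution.
have [F [FU ooF]] := @ultraFilterLemma nat \oo%classic _.
have [l wl] := ultra_bounded_vcvg FU w_bnd.
exists l; apply/l2P; exists (nsq e + c) => -[|m].
  by rewrite big_ord0 addr_ge0 ?nsq_ge0 // (le_trans (nsq_ge0 _) (w_bnd 0%N)).
rewrite big_ord_recl solution0 lerD2l.
have cS : (\sum_(k < m) nsq (solution (w n) e k.+1) @[n --> F] -->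
           \sum_(k < m) nsq (solution l e k.+1))%classic.
  by apply: cvg_sumr => k; apply: cvg_nsq; exact: vcvg_affine.
apply: (cvgr_to_le cS); apply: ooF; exists m => // n /= mn.
apply: le_trans (wP n).
rewrite -(subnKC (leqW mn)) big_split_ord /= lerDl sumr_ge0 // => i _.
exact: nsq_ge0.
Qed.

Lemma weyl_matrix_exists :
  exists W : 'M[C]_d, l2 opnorm (fun n => P_ A B z n *m W + Q_ A B z n).
Proof.
have [w wP] := @choice _ _ (fun j w => l2 normv (solution w (e_ j)))
  (fun j => square_summable_solution (e_ j)).
exists (\matrix_(i, j) w j i 0).
apply: (@le_lt_trans _ _ _ _ _ (l2normsq_opnorm_le _)).
apply: lte_sum_pinfty => j _.
rewrite solution_mulmx; set v := _ *m _.
have -> : v = w j by apply/colP => i; rewrite /v -colE !mxE.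
exact: wP.
Qed.

End Solutions.

(** * Green's formula at infinity, from self-adjointness *)

(** The form that the symmetry of [J] takes on imaginary parts: [f] and [f']
    are the terms of the two scalar products, and their series have opposite
    and equal sums, hence sum zero. *)
Lemma lim_series_opp {R : realType} (f f' a : nat -> R) (c t : R) :
  (forall n, f n = c * a n + (if n is 0%N then t else 0)) ->
  (forall n, f' n = - f n) ->
  cvgn (series a) -> limn (series f) = limn (series f') ->
  c * limn (series a) = - t.
Proof.
move=> fE f'E ac.
have fc : (series f @ \oo --> c * limn (series a) + t)%classic.
  rewrite [series f](_ : _ = fun n => c * series a n + (if n is 0%N then 0 else t)).
    apply: cvgD; first exact: cvgMl_tmp.
    by apply: cvg_near_cst; exists 1%N => // -[].
  apply/funext => n; rewrite /series /= (eq_bigr _ (fun n _ => fE n)).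
  rewrite big_split /= mulr_sumr; congr (_ + _).
  case: n => [|n]; first by rewrite big_nil.
  by rewrite big_nat_recl //= big1 ?addr0.
have -> : series f' = - series f.
  by apply/funext => n; rewrite /series /= fctE -sumrN; apply: eq_bigr.
by rewrite (cvg_lim _ fc) // (cvg_lim _ (cvgN fc)) // => h; lra.
Qed.

Section SelfAdjoint.
Context {R : realType} {d : nat}.
Local Notation C := R[i].
Variables (A B : nat -> 'M[C]_d) (z : C).
Hypothesis saJ : selfadjoint (domJ A B) (Jformal A B).
Hypothesis z_nonreal : complex.Im z != 0.

Definition resolvent_eq (v : 'cV[C]_d) (u : nat -> 'cV[C]_d) : Prop :=
  forall n, Jformal A B u n = z *: u n + delta0 v n.

Lemma domJ_resolvent_eq v u :
  l2 normv u -> resolvent_eq v u -> domJ A B u.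
Proof.
move=> u2 uE; split; first exact: u2.
rewrite (_ : Jformal A B u = fun n => z *: u n + delta0 v n); last exact/funext.
by apply: l2_combination; [exact: u2 | exact: l2_delta0].
Qed.

(** Self-adjointness enters only through the symmetry [<J u, u> = <u, J u>] of
    convergent series.  It stands in for the decay of the flux at infinity, which
    square-summability alone does not give when the [A_n] are unbounded. *)
Lemma l2normsq_resolvent_eq v u : l2 normv u -> resolvent_eq v u ->
  l2normsq normv u = ((complex.Im z)^-1 * complex.Im (dotv (u 0%N) v))%:E.
Proof.
move=> u2 uE; have Du := domJ_resolvent_eq u2 uE.
have [_ _ /(_ u Du)] := (saJ.2 u (Jformal A B u)).2 (conj Du erefl).
move=> /(congr1 (@complex.Im R)) /= symJ.
have [nc ->] := l2_series_cvg u2; congr _%:E.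
have E : complex.Im z * limn (series (fun n => nsq (u n))) =
    - - complex.Im (dotv (u 0%N) v).
  apply: (lim_series_opp _ _ nc symJ) => n; last first.
    by rewrite [dotv (u n) _]dotvC ImC.
  rewrite uE dotvDl dotvZl dotvv ImD ImM mulr0 add0r.
  case: n => [|n] /=; last by rewrite dot0v.
  by rewrite [dotv v _]dotvC ImC.
apply: (mulfI z_nonreal); rewrite mulVKf; last exact: z_nonreal.
by rewrite opprK in E; exact: E.
Qed.

(** The difference solves the equation with source [0], and its norm is then
    [0] by the formula above. *)
Lemma resolvent_eq_uniq v u u' : l2 normv u -> l2 normv u' ->
  resolvent_eq v u -> resolvent_eq v u' -> u = u'.
Proof.
move=> u2 u2' uE uE'; pose x n := -1 *: u' n + u n.
have x2 : l2 normv x by exact: l2_combination.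
have xE : resolvent_eq 0 x.
  move=> n; have -> : Jformal A B x n = -1 *: Jformal A B u' n + Jformal A B u n.
    case: n => [|n] /=; rewrite /x !mulmxDr -!scalemxAr !scalerDr.
      by rewrite addrACA.
    by rewrite [RHS]addrACA; congr (_ + _); rewrite [RHS]addrACA.
  rewrite uE uE' /x !scalerDr !scalerA mulrC addrACA; congr (_ + _).
  by rewrite scaleN1r addNr; case: n.
have := l2normsq_resolvent_eq x2 xE; rewrite dotv0 mulr0 => /l2normsq_eq0 x0.
apply/funext => n; have /eqP := x0 n.
by rewrite /x scaleN1r addrC subr_eq0 => /eqP.
Qed.

End SelfAdjoint.

(** * The Weyl matrix solution *)

Section WeylSolution.
Context {R : realType} {d : nat}.
Local Notation C := R[i].
Variables (A B : nat -> 'M[C]_d) (z : C).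
Hypothesis detA : forall n, \det (A n) != 0.
Hypothesis hermB : forall n, B n = (B n)^t*.
Hypothesis saJ : selfadjoint (domJ A B) (Jformal A B).
Hypothesis z_nonreal : complex.Im z != 0.

Let W := weyl_coef A B z.

Definition weyl_solution_vec (v : 'cV[C]_d) (n : nat) : 'cV[C]_d :=
  solution A B z (W *m v) v n.+1.

Lemma l2_weyl_solution_vec v : l2 normv (weyl_solution_vec v).
Proof.
have W2 : l2 opnorm (fun n => P_ A B z n *m W + Q_ A B z n).
  exact: xgetPex (weyl_matrix_exists detA hermB z_nonreal).
apply: (@l2_shift _ _ (solution A B z (W *m v) v)).
by rewrite -solution_mulmx; exact: ((l2_opnormP _).1 W2 v).
Qed.

Lemma resolvent_eq_weyl_solution_vec v :
  resolvent_eq A B z v (weyl_solution_vec v).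
Proof. by move=> n; exact: Jformal_solution. Qed.

(** The right-hand side shows that the resolvent equation is solvable, so that
    the left-hand side solves it too, and the solution is unique. *)
Lemma weyl_vecE j : weyl_vec A B z j = weyl_solution_vec (e_ j).
Proof.
have u2 := l2_weyl_solution_vec (e_ j).
have uE := resolvent_eq_weyl_solution_vec (e_ j).
have [[w2 _] wE] : domJ A B (weyl_vec A B z j) /\
    (fun n => Jformal A B (weyl_vec A B z j) n - z *: weyl_vec A B z j n)
    = delta0 (e_ j).
  apply: (@xgetPex _ _ [set u | domJ A B u /\
    (fun n => Jformal A B u n - z *: u n) = delta0 (e_ j)]%classic).
  exists (weyl_solution_vec (e_ j)); split; first exact: domJ_resolvent_eq uE.
  by apply/funext => n; rewrite uE addrC addKr.
apply: (resolvent_eq_uniq saJ z_nonreal w2 u2 _ uE) => n.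
by rewrite -wE addrC subrK.
Qed.

Lemma weyl_tilde_mulmx v n : weyl_tilde A B z n *m v = weyl_solution_vec v n.
Proof.
have -> : weyl_tilde A B z n = P_ A B z n.+1 *m W + Q_ A B z n.+1.
  apply/matrixP => i j; rewrite mxE weyl_vecE /weyl_solution_vec.
  by rewrite -solution_mulmx -colE mxE.
by rewrite /weyl_solution_vec -solution_mulmx.
Qed.

Lemma l2normsq_weyl_tilde v :
  l2normsq normv (fun n => weyl_tilde A B z n *m v) =
  ((complex.Im z)^-1 * complex.Im (dotv (W *m v) v))%:E.
Proof.
rewrite (funext (weyl_tilde_mulmx v)).
rewrite (l2normsq_resolvent_eq saJ z_nonreal (l2_weyl_solution_vec v)
  (resolvent_eq_weyl_solution_vec v)).
by rewrite /weyl_solution_vec solution1.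
Qed.

Lemma nsq_weyl_coef_le v :
  nsq (W *m v) <= (complex.Im z)^-1 * complex.Im (dotv (W *m v) v).
Proof.
rewrite -lee_fin -l2normsq_weyl_tilde; apply: le_trans (l2normsq_ge 1 _).
by rewrite big_ord1 weyl_tilde_mulmx /weyl_solution_vec solution1.
Qed.

(** If the norm were [0], the solution would vanish on the nonnegative indices,
    and the equation at index [0] would read [0 = v]. *)
Lemma Im_weyl_coef_gt0 v : v != 0 ->
  0 < (complex.Im z)^-1 * complex.Im (dotv (W *m v) v).
Proof.
move=> v0; rewrite lt_neqAle (le_trans (nsq_ge0 _) (nsq_weyl_coef_le v)) andbT.
apply: contra_neq v0 => S0.
have := l2normsq_weyl_tilde v; rewrite -S0 => /l2normsq_eq0 u0.
have := resolvent_eq_weyl_solution_vec v 0.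
by rewrite /= -!weyl_tilde_mulmx !u0 !mulmx0 scaler0 !add0r => <-.
Qed.

End WeylSolution.

Theorem theorem5p6 (R : realType) (d : nat) (A B : nat -> 'M[R[i]]_d) (z : R[i])
    (d_gt0 : (0 < d)%N)
    (detA : forall n, \det (A n) != 0)
    (hermB : forall n, B n = (B n) ^t*)
    (saJ : selfadjoint (domJ A B) (Jformal A B))
    (z_nonreal : complex.Im z != 0) :
  let W := weyl_coef A B z in
  let Ut := weyl_tilde A B z in
  let U := weyl_sol A B z in
  [/\ forall nu : 'cV[R[i]]_d,
        [/\ dotv (Immx W *m nu) nu \is Num.real,
            ((complex.Im z)^-1 * complex.Re (dotv (Immx W *m nu) nu))%:E
              = l2normsq normv (fun n => Ut n *m nu),
            l2normsq normv (fun n => Ut n *m nu)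
              = seminorm0sq normv (fun n => U n *m nu)
          & (((normv (W *m nu)) ^+ 2)%:E
              <= seminorm0sq normv (fun n => U n *m nu))%E],
      0 < complex.Im z -> strictly_positive (Immx W),
      complex.Im z < 0 -> strictly_negative (Immx W)
    & [/\ \tr (Immx W) \is Num.real,
          l2normsq opnorm Ut = seminorm0sq opnorm U
        & (seminorm0sq opnorm U
            <= (complex.Re (\tr (Immx W)) / complex.Im z)%:E)%E]].
Proof.
move=> W Ut U.
have normU v : l2normsq normv (fun n => Ut n *m v) =
    ((complex.Im z)^-1 * complex.Im (dotv (W *m v) v))%:E.
  exact: l2normsq_weyl_tilde.
have posU v := Im_weyl_coef_gt0 detA hermB saJ z_nonreal (v := v).
split=> [nu|z_gt0 v v0|z_lt0 v v0|].
- rewrite dotv_Immx; split=> //; first by rewrite complex_real.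
  rewrite normvK [leRHS]normU lee_fin; exact: nsq_weyl_coef_le.
- by rewrite dotv_Immx ltcR; have := posU v v0; rewrite pmulr_rgt0 ?invr_gt0.
- rewrite dotv_Immx -[0]/(0%:C%C) ltcR.
  by have := posU v v0; rewrite nmulr_rgt0 ?invr_lt0.
- rewrite mxtrace_Immx; split=> //; first by rewrite complex_real.
  apply: le_trans (l2normsq_opnorm_le Ut) _.
  rewrite (eq_bigr _ (fun j _ => normU (e_ j))) sumEFin lee_fin.
  by rewrite -mulr_sumr mulrC.
Qed.
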